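(* $$\int_0^{\pi/2} e^{-\csc^2(x)}\,dx = \frac{\pi}{2}\,\mathrm{erfc}(1).$$
   Context: The complementary error function is $\mathrm{erfc}(x)=\frac{2}{\sqrt{\pi}}\int_x^{\infty} e^{-t^2}\,dt$. *)

(* Defs.v *)
From HB Require Import structures.
From mathcomp Require Import all_boot all_order all_algebra.
From mathcomp Require Import all_classical all_reals all_analysis.

Set Implicit Arguments.
Unset Strict Implicit.
Unset Printing Implicit Defensive.

Import Order.TTheory GRing.Theory Num.Theory.
Import numFieldNormedType.Exports.

Local Open Scope classical_set_scope.
Local Open Scope ring_scope.

(* csc x takes the junk value 0 at the zeros of sin. *)
Definition csc {R : realType} (x : R) : R := (sin x)^-1.

Definition erfc {R : realType} (x : R) : R :=
  2 / Num.sqrt pi *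
  \int[lebesgue_measure]_(t in `[x, +oo[) expR (- (t ^+ 2)).

(* Main.v *)
(* Substituting x = pi/2 - atan t, so that csc^2 x = 1 + t^2, turns the integral
   into that of exp(-(1 + t^2)) / (1 + t^2) over t >= 0. Writing this integrand
   as the integral of 2 s exp(-s^2 (1 + t^2)) over s >= 1, Tonelli's theorem
   exchanges the integrals: the integral of s exp(-s^2 t^2) over t is the Gauss
   integral sqrt(pi) / 2, and sqrt(pi) exp(-s^2) over s >= 1 remains. *)
Require Import Defs.
From HB Require Import structures.
From mathcomp Require Import all_boot all_order all_algebra.
From mathcomp Require Import all_classical all_reals all_analysis.
From mathcomp Require Import measurable_realfun ring.

Set Implicit Arguments.
Unset Strict Implicit.
Unset Printing Implicit Defensive.

Import Order.TTheory GRing.Theory Num.Theory.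
Import numFieldNormedType.Exports.

Local Open Scope classical_set_scope.
Local Open Scope ring_scope.

(** Extending [f] by zero outside the rectangle reduces this to Tonelli on the whole product. The
    sign of [f] then matters on the rectangle only. *)
Lemma fubini_tonelli_setX (d1 d2 : measure_display) (T1 : measurableType d1)
    (T2 : measurableType d2) (R : realType)
    (m1 : {sigma_finite_measure set T1 -> \bar R})
    (m2 : {sigma_finite_measure set T2 -> \bar R})
    (A : set T1) (B : set T2) (f : T1 * T2 -> \bar R) :
  measurable A -> measurable B -> measurable_fun setT f ->
  (forall z, (A `*` B) z -> 0 <= f z)%E ->
  (\int[m1]_(x in A) \int[m2]_(y in B) f (x, y) =
   \int[m2]_(y in B) \int[m1]_(x in A) f (x, y))%E.
Proof.
move=> mA mB mf f0.
pose g := f \_ (A `*` B).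
have mAB : measurable (A `*` B) by exact: measurableX.
have := @fubini_tonelli _ _ T1 T2 R m1 m2 g.
have mg : measurable_fun setT g by apply/(measurable_restrictT _ _).1 => //; exact: measurable_funTS.
have g0 z : (0 <= g z)%E by apply: erestrict_ge0.
move=> /(_ mg g0) E.
have gE x y : g (x, y) = if (x \in A) && (y \in B) then f (x, y) else 0%E.
  by rewrite /g /patch in_setX.
transitivity (\int[m1]_x \int[m2]_y g (x, y))%E; last rewrite E.
- rewrite integral_mkcond; apply: eq_integral => x _ /=.
  rewrite /patch; case: ifPn => xA; last first.
    by rewrite integral0_eq// => y _; rewrite gE (negbTE xA).
  rewrite integral_mkcond; apply: eq_integral => y _ /=.
  by rewrite gE xA.
- rewrite [RHS]integral_mkcond; apply: eq_integral => y _ /=.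
  rewrite /patch; case: ifPn => yB; last first.
    by rewrite integral0_eq// => x _; rewrite gE (negbTE yB) andbF.
  rewrite [RHS]integral_mkcond; apply: eq_integral => x _ /=.
  by rewrite gE yB andbT.
Qed.

Section gauss_csc.
Context {R : realType}.
Let mu := @lebesgue_measure R.

Lemma is_derive_gauss_fun_scale (a s : R) :
  is_derive s 1 (fun s => gauss_fun (s * a))
    (- (2 * s * a ^+ 2) * gauss_fun (s * a)).
Proof.
rewrite /gauss_fun.
apply: is_derive_eq.
rewrite /GRing.scale /=; ring.
Qed.

Lemma continuous_scale (s : R) : continuous (fun t : R => s * t).
Proof. by move=> x; apply: cvgM; [exact: cvg_cst|exact: cvg_id]. Qed.

Lemma continuous_gauss_fun_scale (s : R) :
  continuous (fun t : R => gauss_fun (s * t)).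
Proof.
move=> x; apply: (@continuous_comp _ _ _ (fun t => s * t) gauss_fun).
  exact: continuous_scale.
exact: continuous_gauss_fun.
Qed.

(** The substitution u = s t has derivative [s], so this is the Gauss integral over the
    half-line. *)
Lemma integral0y_gauss_scale (s : R) : 0 < s ->
  (\int[mu]_(t in `[0%R, +oo[) (s * gauss_fun (s * t))%:E =
   (Num.sqrt pi / 2)%:E)%E.
Proof.
move=> s0.
have D : derive1 ( *%R s) = cst s.
  by apply/funext => z; rewrite derive1E derive_val /GRing.scale/= mulr1.
(* The lower bound 0 becomes [s * 0], the image of 0 under the substitution. *)
rewrite -integral0y_gauss -[in RHS](mulr0 s).
rewrite (@increasing_ge0_integration_by_substitutiony _ ( *%R s)).
- by apply: eq_integral => t _; rewrite D !fctE /= mulrC.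
- by move=> x y _ _ xy; rewrite ltr_pM2l.
- by rewrite D => ? _; exact: cvg_cst.
- by rewrite D; exact: is_cvg_cst.
- by rewrite D; exact: is_cvg_cst.
- split; first by move=> x _; exact: ex_derive.
  by apply: cvg_at_right_filter; exact: continuous_scale.
- by apply: gt0_cvgMry => //; exact: cvg_id.
- by apply: continuous_subspaceT; exact: continuous_gauss_fun.
- by move=> x _; exact: gauss_fun_ge0.
Qed.

(** The antiderivative [F] below tends to 0 at infinity, so only - F(1) remains. *)
Lemma integral1y_gauss_scale (a : R) : 0 < a ->
  (\int[mu]_(s in `[1%R, +oo[) (2 * s * gauss_fun (s * a))%:E =
   (gauss_fun a / a ^+ 2)%:E)%E.
Proof.
move=> a0.
pose F s := - (gauss_fun (s * a) / a ^+ 2).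
have dF (s : R) : is_derive s 1 F (2 * s * gauss_fun (s * a)).
  have ? := is_derive_gauss_fun_scale a s.
  apply: is_derive_eq.
  rewrite /GRing.scale /=; field.
  by rewrite gt_eqF.
rewrite (@ge0_continuous_FTC2y _ _ F _ 0).
- by rewrite /F mul1r sub0e -EFinN opprK.
- move=> x x1; rewrite !mulr_ge0 ?gauss_fun_ge0//.
  exact: le_trans x1.
- apply: continuous_subspaceT => x.
  apply: cvgM; first exact: continuous_scale.
  have := @continuous_gauss_fun_scale a x.
  by under eq_fun do rewrite mulrC.
- rewrite -oppr0; apply: cvgN; rewrite -[X in _ --> X](mul0r (a ^- 2)).
  apply: cvgM; last exact: cvg_cst.
  apply: (@cvg_comp _ _ _ (fun s => s * a) gauss_fun _ +oo); last exact: cvg_gauss_fun.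
  by apply: gt0_cvgMly => //; exact: cvg_id.
- by move=> x _; exact: ex_derive.
- apply: cvg_at_right_filter.
  by apply/differentiable_continuous/derivable1_diffP; exact: ex_derive.
- by move=> x _; rewrite derive1E derive_val.
Qed.
(** The square root puts exp(-(1 + t^2)) in the form [gauss_fun a], so that [integral1y_gauss_scale]
    applies with [a ^+ 2] equal to 1 + t^2. *)
Lemma integral0y_gauss_sqrt_oneDsqr :
  (\int[mu]_(t in `[0%R, +oo[) (gauss_fun (Num.sqrt (1 + t ^+ 2)) / (1 + t ^+ 2))%:E =
   (Num.sqrt pi)%:E * \int[mu]_(s in `[1%R, +oo[) (gauss_fun s)%:E)%E.
Proof.
have sq_gt0 (t : R) : 0 < 1 + t ^+ 2 by rewrite ltr_pwDl// sqr_ge0.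
pose f (z : R * R) := 2 * z.2 * gauss_fun (z.2 * Num.sqrt (1 + z.1 ^+ 2)).
transitivity (\int[mu]_(t in `[0%R, +oo[) \int[mu]_(s in `[1%R, +oo[) (f (t, s))%:E)%E.
  apply: eq_integral => t _.
  rewrite /f /= integral1y_gauss_scale ?sqrtr_gt0//.
  by rewrite sqr_sqrtr// ltW.
(* [f] is negative for s < 0, hence the version of Tonelli relative to a rectangle. *)
rewrite (@fubini_tonelli_setX _ _ _ _ _ mu mu _ _ (EFin \o f))//; last 2 first.
- apply: measurableT_comp => //; apply: measurable_funM.
    by apply: measurable_funM => //; exact: measurable_snd.
  apply: measurableT_comp; first exact: measurable_gauss_fun.
  apply: measurable_funM; first exact: measurable_snd.
  apply: (@measurableT_comp _ _ _ _ _ _ (@Num.sqrt R)).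
    by apply: continuous_measurable_fun; exact: sqrt_continuous.
  apply: measurable_funD => //.
  by apply: measurable_funX; exact: measurable_fst.
- move=> [t s] [/= _]; rewrite in_itv/= andbT => s1.
  by rewrite lee_fin !mulr_ge0 ?gauss_fun_ge0// (le_trans _ s1).
rewrite -ge0_integralZl//; last 2 first.
- by apply/measurable_EFinP/measurable_funTS; exact: measurable_gauss_fun.
- by move=> s _; rewrite lee_fin gauss_fun_ge0.
apply: eq_integral => s; rewrite inE/= in_itv/= andbT => s1.
have s0 : 0 < s by rewrite (lt_le_trans _ s1).
(* The exponential splits as exp(-s^2) exp(-s^2 t^2). The factor [s] stays inside, as the derivative
   of the scaling. *)
transitivity (\int[mu]_(t in `[0%R, +oo[)
    ((2 * gauss_fun s)%:E * (s * gauss_fun (s * t))%:E))%E.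
  apply: eq_integral => t _; rewrite /f/= -EFinM; congr EFin.
  rewrite -!mulrA; congr (_ * _); rewrite mulrCA; congr (_ * _).
  rewrite /gauss_fun -expRD; congr expR.
  by rewrite !exprMn sqr_sqrtr ?ltW//; ring.
rewrite ge0_integralZl//; last 3 first.
- apply/measurable_EFinP/measurable_funTS/measurable_funM => //.
  apply: measurableT_comp; first exact: measurable_gauss_fun.
  exact: measurable_funM.
- by move=> t _; rewrite lee_fin mulr_ge0 ?gauss_fun_ge0// ltW.
- by rewrite lee_fin mulr_ge0 ?gauss_fun_ge0.
by rewrite integral0y_gauss_scale// -!EFinM; congr EFin; field.
Qed.

(** The decreasing substitution x = pi/2 - atan t is made on each segment [0, n], and monotone
    convergence passes to the limit on both sides. Leaving 0 out of the interval admits a [G] that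
    is discontinuous there. *)
Lemma integral_pihalfBatan (G : R -> R) :
  {within `]0, (pi / 2)], continuous G} -> (forall x, 0 <= G x) ->
  (\int[mu]_(x in `]0%R, (pi / 2)%R]) (G x)%:E =
   \int[mu]_(t in `[0%R, +oo[) (G (pi / 2 - atan t) / (1 + t ^+ 2))%:E)%E.
Proof.
move=> cG G0.
pose F (t : R) := pi / 2 - atan t.
have F_gt0 t : 0 < F t by rewrite subr_gt0 atan_ltpi2.
have F0 : F 0 = pi / 2 by rewrite /F atan0 subr0.
have dF (t : R) : is_derive t 1 F (- (1 + t ^+ 2)^-1).
  have := is_deriveB (is_derive_cst (pi / 2 : R) t 1) (is_derive1_atan t).
  by rewrite sub0r.
have D : derive1 F = fun t => - (1 + t ^+ 2)^-1.
  by apply/funext => t; rewrite derive1E derive_val.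
have cD : continuous (derive1 F).
  rewrite D => t; apply: cvgN; exact: continuous_oneDsqrV.
have cF : continuous F.
  by move=> t; apply/differentiable_continuous/derivable1_diffP; exact: ex_derive.
have F_decr x y : x < y -> F y < F x by move=> xy; rewrite ltrD2l ltrN2 lt_atan.
have F_decrW x y : x <= y -> F y <= F x by move=> xy; rewrite lerD2l lerN2 le_atan.
have F_le t : 0 <= t -> F t <= pi / 2 by rewrite -F0; exact: F_decrW.
have FnS n : `[F n%:R, (pi / 2)] `<=` `]0, (pi / 2)].
  by move=> x; rewrite /= !in_itv/= => /andP[nx ->]; rewrite (lt_le_trans _ nx).
(* The left ends are positive and tend to 0, since atan n tends to pi/2. *)
have UA : \bigcup_n [set` `[F n%:R, (pi / 2)]] = `]0, (pi / 2)]%classic.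
  apply/seteqP; split => [x [n _]|x]; first exact: FnS.
  rewrite /= in_itv/= => /andP[x0 xpi].
  have : F n%:R @[n --> \oo] --> (0 : R).
    rewrite -[X in _ --> X](subrr (pi / 2)); apply: cvgB; first exact: cvg_cst.
    exact: (cvg_comp _ _ (@cvgr_idn R) (@cvgy_atan R)).
  move=> /cvgr_lt /(_ x x0)[n _ /(_ n (leqnn n))/= Fnx].
  by exists n => //=; rewrite in_itv/= xpi ltW.
have UB : \bigcup_n [set` `[0, n%:R]] = `[0, +oo[%classic :> set R.
  apply/seteqP; split => [x [n _]|x].
    by rewrite /= !in_itv/= andbT => /andP[].
  rewrite /= in_itv/= andbT => x0.
  exists (Num.bound x) => //=; rewrite in_itv/= x0/= ltW//.
  exact: archi_boundP.
have mG : measurable_fun `]0, (pi / 2)] G.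
  exact: subspace_continuous_measurable_fun.
have E n : (\int[mu]_(x in `[F n%:R, (pi / 2)%R]) (G x)%:E =
    \int[mu]_(t in `[0%R, n%:R]) (G (F t) / (1 + t ^+ 2))%:E)%E.
  (* With pi/2 written as [F 0], the bounds are the images of n and 0 in reversed order. This
     reversal cancels the minus sign of the derivative. *)
  rewrite -F0 integration_by_substitution_decreasing//.
  - by apply: eq_integral => t _; rewrite D /= !fctE opprK.
  - by move=> x y _ _; exact: F_decr.
  - by apply/cvg_ex; eexists; apply: cvg_at_right_filter; exact: cD.
  - by apply/cvg_ex; eexists; apply: cvg_at_left_filter; exact: cD.
  - split; first by move=> x _; exact: ex_derive.
    + by apply: cvg_at_right_filter; exact: cF.
    + by apply: cvg_at_left_filter; exact: cF.
  - by rewrite F0; exact: continuous_subspaceW cG.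
have cA : (\int[mu]_(x in `[F n%:R, (pi / 2)%R]) (G x)%:E @[n --> \oo] -->
    \int[mu]_(x in `]0%R, (pi / 2)%R]) (G x)%:E)%E.
  rewrite -UA; apply: ge0_nondecreasing_set_cvg_integral => //.
  - move=> m n mn; apply/subsetPset; apply: subset_itvr; rewrite bnd_simp.
    by rewrite F_decrW// ler_nat.
  - by move=> n; apply/measurable_EFinP; exact: measurable_funS mG.
  - by move=> n x _; rewrite lee_fin.
have cB : (\int[mu]_(t in `[0%R, n%:R]) (G (F t) / (1 + t ^+ 2))%:E @[n --> \oo] -->
    \int[mu]_(t in `[0%R, +oo[) (G (F t) / (1 + t ^+ 2))%:E)%E.
  rewrite -UB; apply: ge0_nondecreasing_set_cvg_integral => //.
  - move=> m n mn; apply/subsetPset; apply: subset_itvl; rewrite bnd_simp.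
    by rewrite ler_nat.
  - move=> n; apply/measurable_EFinP; apply: measurable_funM; last first.
      by apply: measurable_funTS; apply: continuous_measurable_fun;
        exact: continuous_oneDsqrV.
    (* [G] is known to be measurable only on ]0, pi/2], so [F] has to map [0, n] into it. *)
    apply: (measurable_comp _ _ mG) => //.
      move=> _ [t /= + <-]; rewrite !in_itv/= => /andP[t0 _].
      by rewrite F_gt0 F_le.
    by apply: measurable_funTS; exact: continuous_measurable_fun.
  - by move=> n x _; rewrite lee_fin divr_ge0// addr_ge0// sqr_ge0.
move: cA; under eq_cvg do rewrite E; move=> cA.
exact: cvg_unique cA cB.
Qed.

(** The sine of pi/2 - y is cos y, and cos (atan t) is the inverse of the root. *)
Lemma csc_pihalfBatan (t : R) : csc (pi / 2 - atan t) = Num.sqrt (1 + t ^+ 2).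
Proof.
by rewrite /csc -[_ - _]opprB sinN sinBpihalf opprK cos_atan invrK.
Qed.

Lemma continuous_csc (x : R) : sin x != 0 -> {for x, continuous csc}.
Proof. by move=> sx0; apply: cvgV => //; exact: continuous_sin. Qed.
End gauss_csc.

Theorem theorem3p6 (R : realType) :
  (\int[@lebesgue_measure R]_(x in `]0%R, (pi / 2)%R]) (expR (- (csc x ^+ 2)))%:E
   = (pi / 2 * erfc 1)%:E)%E.
Proof.
(* At 0 the junk value of [csc] makes this integrand 1, while its limit from the right is 0. On ]0,
   pi/2] the sine is positive and continuity holds. *)
rewrite (@integral_pihalfBatan R (gauss_fun \o csc)); last 2 first.
- apply: continuous_in_subspaceT => x; rewrite inE /= in_itv/= => /andP[x0 xpi].
  apply: continuous_comp; last exact: continuous_gauss_fun.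
  apply/continuous_csc/lt0r_neq0/sin_gt0_pi; rewrite x0/= (le_lt_trans xpi)//.
  by rewrite ltr_pdivrMr// ltr_pMr ?pi_gt0// ltr1n.
- by move=> x; exact: gauss_fun_ge0.
under eq_integral do rewrite /= csc_pihalfBatan.
(* [erfc] uses a real-valued integral, so the extended one must be shown finite. This follows from
   integrability of the Gaussian on the whole line. *)
rewrite integral0y_gauss_sqrt_oneDsqr /erfc /Rintegral -[X in (_ * X)%E]fineK; last first.
  apply: integrable_fin_num => //.
  exact: integrableS (@integrableT_gauss R).
rewrite -EFinM; congr EFin; rewrite mulrA; congr (_ * _).
have p0 : Num.sqrt pi != 0 :> R by rewrite gt_eqF// sqrtr_gt0 pi_gt0.
(* Writing the pi of [pi / 2] as the square of its root leaves a rational identity in that root. *)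
rewrite -{2}(@sqr_sqrtr R pi) ?pi_ge0//.
by field.
Qed.
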